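(* Let $h:\mathbb{R}^n\to\mathbb{R}^m$ be differentiable at $\mu\in\mathbb{R}^n$ with Jacobian $H=\frac{\mathrm{d}h}{\mathrm{d}x}\big|_{x=\mu}\in\mathbb{R}^{m\times n}$, and let $H^\dagger\in\mathbb{R}^{n\times m}$ satisfy $HH^\dagger=I_m$. Let $A\in\mathbb{R}^{p\times m}$ and $b\in\mathbb{R}^p$ be such that $P(A,b)\subset\mathbb{R}^m$ is an $\mathcal{H}$-polytope. Then the extended approximation of the measurement polyhedron, $$Ph_{Y} := H^\dagger P(A,b) + \mu - H^\dagger h(\mu),$$ is the $\mathcal{H}$-polyhedron in $\mathbb{R}^n$ $$Ph_{Y} = Ph\bigl(AH,\; b + AH\mu - A\,h(\mu)\bigr).$$
   Context: For $A\in\mathbb{R}^{p\times d}$ and $b\in\mathbb{R}^p$, $Ph(A,b)=\{x\in\mathbb{R}^d : Ax\le b\}$ (componentwise inequality) is an $\mathcal{H}$-polyhedron; when this set is bounded it is called an $\mathcal{H}$-polytope and is denoted $P(A,b)$. For an $\mathcal{H}$-polytope $P(A,b)\subset\mathbb{R}^m$ in measurement space and a matrix $H\in\mathbb{R}^{m\times n}$ with pseudo-inverse $H^\dagger$, the notation $H^\dagger P(A,b)$ means the full-space polyhedron $Ph(AH,b)=\{x\in\mathbb{R}^n: Hx\in P(A,b)\}$ (not the image of $P(A,b)$ under the matrix $H^\dagger$). For a set $S\subset\mathbb{R}^n$ and $c\in\mathbb{R}^n$, $S+c=\{s+c:s\in S\}$. In the application, $\mu$ is the prior mean, $h$ is the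 measurement operator, and $P(A,b)$ is the support of the uniform measurement uncertainty; the set $Ph_Y$ arises by replacing the right inverse of $h$ by its first-order affine approximation $z\mapsto \mu-H^\dagger h(\mu)+H^\dagger z$. *)

(* Defs.v *)
From HB Require Import structures.
From mathcomp Require Import all_boot all_order all_algebra.
From mathcomp Require Import all_classical all_reals all_analysis.

Set Implicit Arguments.
Unset Strict Implicit.
Unset Printing Implicit Defensive.

Import Order.TTheory GRing.Theory Num.Theory.
Import numFieldNormedType.Exports.

Local Open Scope classical_set_scope.
Local Open Scope ring_scope.

(* The dimensions may be 0, and the solution set may be empty. *)
Definition Ph (R : realType) (p d : nat) (A : 'M[R]_(p, d)) (b : 'cV[R]_p) :
    set 'cV[R]_d :=
  [set x | forall i : 'I_p, (A *m x) i 0 <= b i 0].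

(* The norm on 'cV[R]_d behind bounded_set is the max norm. *)
Definition Hpolytope (R : realType) (p d : nat) (A : 'M[R]_(p, d))
    (b : 'cV[R]_p) : Prop :=
  bounded_set (Ph A b).

(* The set written H^dagger P(A, b) in the literature on measurement
   polyhedra: despite the notation it depends on H only, and it is not the
   image of P(A, b) under a right inverse of H. *)
Definition full_space (R : realType) (m n p : nat) (H : 'M[R]_(m, n))
    (A : 'M[R]_(p, m)) (b : 'cV[R]_p) : set 'cV[R]_n :=
  Ph (A *m H) b.

Lemma full_spaceE (R : realType) (m n p : nat) (H : 'M[R]_(m, n))
    (A : 'M[R]_(p, m)) (b : 'cV[R]_p) :
  full_space H A b = [set x | Ph A b (H *m x)].
Proof. by apply/seteqP; split=> x + i => /(_ i); rewrite mulmxA. Qed.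

Definition translate (V : zmodType) (S : set V) (c : V) : set V :=
  [set s + c | s in S].

(* The library's 'J is for maps between row vectors and acts on the right, so
   it is conjugated by transposition here; jacobian_colE checks the result. *)
Definition jacobian_col (R : realType) (n m : nat)
    (h : 'cV[R]_n -> 'cV[R]_m) (mu : 'cV[R]_n) : 'M[R]_(m, n) :=
  (jacobian (fun x : 'rV[R]_n => (h x^T)^T) mu^T)^T.

Lemma trmx_continuous (R : realType) (k l : nat) :
  continuous (@trmx R k l).
Proof.
move=> M P [B MB BP]; exists (fun i j => B j i) => [i j|N NB].
  by have := MB j i; rewrite mxE.
by apply: BP => i j; rewrite mxE; exact: NB.
Qed.

Lemma jacobian_colE (R : realType) (n m : nat)
    (h : 'cV[R]_n -> 'cV[R]_m) (mu v : 'cV[R]_n) :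
  differentiable h mu -> 'd h mu v = jacobian_col h mu *m v.
Proof.
move=> dh.
have dT k l (M : 'M[R]_(k, l)) : differentiable (@trmx R k l) M.
  by apply: linear_differentiable; exact: trmx_continuous.
have ddT k l (M : 'M[R]_(k, l)) : 'd (@trmx R k l) M = @trmx R k l :> (_ -> _).
  by apply: diff_lin; exact: trmx_continuous.
have dh' : differentiable h (mu^T)^T by rewrite trmxK.
have dhT : differentiable (h \o trmx) mu^T by exact: differentiable_comp.
have dThT : differentiable (trmx \o (h \o trmx)) mu^T.
  exact: differentiable_comp.
rewrite /jacobian_col -[v in RHS]trmxK -trmx_mul.
rewrite -(@deriveEjacobian _ _ _ (trmx \o (h \o trmx)))// deriveE//.
rewrite (diff_comp (f := h \o trmx) (g := trmx))// ddT /=.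
by rewrite (diff_comp (f := trmx) (g := h))// ddT /= !trmxK.
Qed.

Definition PhY (R : realType) (n m p : nat) (h : 'cV[R]_n -> 'cV[R]_m)
    (mu : 'cV[R]_n) (H : 'M[R]_(m, n)) (Hdag : 'M[R]_(n, m))
    (A : 'M[R]_(p, m)) (b : 'cV[R]_p) : set 'cV[R]_n :=
  translate (full_space H A b) (mu - Hdag *m h mu).

(* Main.v *)
Require Import Defs.
From mathcomp Require Import all_boot all_order all_algebra.
From mathcomp Require Import all_classical all_reals all_analysis.

Import Order.TTheory GRing.Theory Num.Theory.
Import numFieldNormedType.Exports.

Local Open Scope classical_set_scope.
Local Open Scope ring_scope.

(** Translating a polyhedron keeps its matrix [M] and only shifts its bounds, because [M s <= b] is
    equivalent to [M (s + c) <= b + M c]; this is [translate_Ph]. With [M = A H] and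
    [c = mu - Hdag h(mu)], the shift is [A H mu - A H Hdag h(mu)], and its last term is [A h(mu)]
    since [Hdag] is a right inverse of [H]. *)

Lemma translate_Ph (R : realType) (p d : nat) (A : 'M[R]_(p, d))
    (b : 'cV[R]_p) (c : 'cV[R]_d) :
  translate (Ph A b) c = Ph A (b + A *m c).
Proof.
apply/seteqP; split=> [_ [s sAb <-] i|x xAb].
  by rewrite mulmxDr !mxE lerD2r; have := sAb i; rewrite mxE.
exists (x - c); last by rewrite subrK.
by move=> i; have := xAb i; rewrite mulmxBr !mxE lerBlDr.
Qed.

Theorem theorem3p3 (R : realType) (n m p : nat)
    (h : 'cV[R]_n -> 'cV[R]_m) (mu : 'cV[R]_n)
    (H : 'M[R]_(m, n)) (Hdag : 'M[R]_(n, m))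
    (A : 'M[R]_(p, m)) (b : 'cV[R]_p)
    (h_diff : differentiable h mu)
    (H_jac : H = jacobian_col h mu)
    (H_Hdag : H *m Hdag = 1%:M)
    (Ab_polytope : Hpolytope A b) :
  PhY h mu H Hdag A b = Ph (A *m H) (b + A *m H *m mu - A *m h mu).
Proof.
rewrite /PhY /full_space translate_Ph mulmxBr addrA.
(* The product stands as [(A H) (Hdag h(mu))]; two reassociations isolate the factor [H Hdag], which
   is the identity. *)
by rewrite -[A *m H *m (Hdag *m _)]mulmxA [H *m (Hdag *m _)]mulmxA H_Hdag mul1mx.
Qed.
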